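(* Let $\mu_1,\mu_2,\mu_3$ be three mass distributions in $\mathbb{R}^2$ and let $q$ be a point of $\mathbb{R}^2$. Then there exist two lines $\ell_1,\ell_2$ (where $\ell_2$ may be a line at infinity) such that $\{\ell_1,\ell_2\}$ simultaneously bisects $\mu_1,\mu_2,\mu_3$ and $\ell_1$ goes through $q$.
   Context: A mass distribution $\mu$ on $\mathbb{R}^2$ is a measure such that all open subsets are measurable, $0<\mu(\mathbb{R}^2)<\infty$, and $\mu(S)=0$ for every lower-dimensional subset $S$. For a finite set $\mathcal{L}$ of oriented lines, each $\ell\in\mathcal{L}$ has positive side $\ell^+=\{x: g(x)\ge 0\}$ for a defining affine function $g(x)=a_1x_1+a_2x_2+a_0$; lines at infinity ($g\equiv a_0\neq 0$ constant) are allowed, with $\ell^+=\mathbb{R}^2$, $\ell^-=\emptyset$. Let $\lambda(p)$ be the number of lines of $\mathcal{L}$ having $p$ on their positive side, $R^+=\{p:\lambda(p)\text{ even}\}$, $R^-=\{p:\lambda(p)\text{ odd}\}$. $\mathcal{L}$ simultaneously bisects $\mu_1,\dots,\mu_k$ if $\mu_i(R^+)=\mu_i(R^-)$ for all $i$; an unoriented set of lines bisects if some orientation does. *)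

(* Defs.v *)
From HB Require Import structures.
From mathcomp Require Import all_boot all_order all_algebra.
From mathcomp Require Import all_classical all_reals all_analysis.
Set Implicit Arguments. Unset Strict Implicit. Unset Printing Implicit Defensive.
Import Order.TTheory GRing.Theory Num.Theory.
Local Open Scope classical_set_scope.
Local Open Scope ring_scope.

(* Points of R^2 are pairs (x1, x2) : R * R, with the product sigma-algebra
   (generated by Borel rectangles; it contains all open sets of R^2). *)

(* An oriented line (possibly at infinity) is given by the coefficients
   (a1, a2, a0) of its defining affine function g(x) = a1 x1 + a2 x2 + a0,
   not all zero.  If a1 = a2 = 0 it is a line at infinity. *)
Definition oline (R : realType) := (R * R * R)%type.

Definition aff (R : realType) (l : oline R) (p : R * R) : R :=
  l.1.1 * p.1 + l.1.2 * p.2 + l.2.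

Definition valid_line (R : realType) (l : oline R) : Prop :=
  l != (0, 0, 0).

Definition at_infinity (R : realType) (l : oline R) : bool :=
  (l.1.1 == 0) && (l.1.2 == 0).

Definition pos_side (R : realType) (l : oline R) (p : R * R) : bool :=
  if at_infinity l then true else 0 <= aff l p.

Definition line_set (R : realType) (l : oline R) : set (R * R) :=
  [set p | aff l p = 0].

Definition same_line (R : realType) (l1 l2 : oline R) : Prop :=
  exists c : R, c != 0 /\ l2 = (c * l1.1.1, c * l1.1.2, c * l1.2).

Definition lambda (R : realType) (L : seq (oline R)) (p : R * R) : nat :=
  count (fun l => pos_side l p) L.

Definition Rplus (R : realType) (L : seq (oline R)) : set (R * R) :=
  [set p | ~~ odd (lambda L p)].
Definition Rminus (R : realType) (L : seq (oline R)) : set (R * R) :=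
  [set p | odd (lambda L p)].

Definition mass_distribution (R : realType)
  (mu : {measure set (R * R)%type -> \bar R}) : Prop :=
  (0 < mu setT)%E /\ (mu setT < +oo)%E /\
  (forall l : oline R, ~~ at_infinity l -> mu (line_set l) = 0%E).

Definition bisects (R : realType) (L : seq (oline R))
  (mu : {measure set (R * R)%type -> \bar R}) : Prop :=
  mu (Rplus L) = mu (Rminus L).

(* Main.v *)
Require Import Defs.
From HB Require Import structures.
From mathcomp Require Import all_boot all_order all_algebra.
From mathcomp Require Import all_classical all_reals all_analysis.
From mathcomp Require Import measurable_realfun ring lra zify.
Set Implicit Arguments. Unset Strict Implicit. Unset Printing Implicit Defensive.
Import Order.TTheory GRing.Theory Num.Theory.
Import numFieldNormedType.Exports.

(** The oriented lines through q form a circle, and the oriented lines of the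
    plane, including those at infinity, a 2-sphere.  The signed imbalances of
    the three masses give a continuous map from the product of these spheres to
    R^3 that is odd in each factor, and it must vanish: cut open to a map f on
    the cube [-1, 1]^3, it satisfies f(1, y) = - f(-1, y), and
    f(s, -y) = - f(s, y) for y on the boundary of the square.  If f had no zero,
    label the points of a fine grid by the axis of the largest coordinate of f
    and its sign.  No cube of the grid would then contain two opposite labels,
    and a parity count of alternating triangles, in the manner of Tucker's and
    Fan's lemmas, gives a contradiction. *)

(** * Parity of alternating labels on a grid *)

Inductive axis := Ax1 | Ax2 | Ax3.
Definition label := (bool * axis)%type.

Definition axis_lt (i j : axis) : bool :=
  match i, j with Ax1, Ax2 | Ax1, Ax3 | Ax2, Ax3 => true | _, _ => false end.
Definition neq_axis (i j : axis) : bool := axis_lt i j || axis_lt j i.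

Definition opp_label (a : label) : label := (~~ a.1, a.2).
(** Fails only for two labels on the same axis with opposite signs, the complementary pair of
    Tucker's lemma. *)
Definition noncompl (a b : label) : bool := neq_axis a.2 b.2 || (a.1 == b.1).

(* Alternating labels, as in Ky Fan's lemma: the signs alternate along the axes,
   starting with [s]. *)
Definition alt_vertex (s : bool) (a : label) : bool :=
  match a.2 with Ax2 => a.1 != s | _ => a.1 == s end.
Definition alt_edge (s : bool) (a b : label) : bool :=
  axis_lt a.2 b.2 && (a.1 == s) && (b.1 != s)
  || axis_lt b.2 a.2 && (b.1 == s) && (a.1 != s).
Definition alt_triangle (s : bool) (a b c : label) : bool :=
  [&& alt_vertex s a, alt_vertex s b & alt_vertex s c]
  && [&& neq_axis a.2 b.2, neq_axis a.2 c.2 & neq_axis b.2 c.2].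
(** The corners are in cyclic order and the square is cut along the diagonal from [a] to [c]; counts
    are kept modulo 2, hence the exclusive or. *)
Definition alt_quad (s : bool) (a b c d : label) : bool :=
  alt_triangle s a b c (+) alt_triangle s a d c.

Lemma alt_edge_opp s a b :
  alt_edge s (opp_label a) (opp_label b) = alt_edge (~~ s) a b.
Proof. by case: s a b => [] [[] []] [[] []]. Qed.

Lemma alt_edge_sym s a b : alt_edge s a b = alt_edge s b a.
Proof. by rewrite /alt_edge orbC. Qed.

(** Different signs force different axes, and the edge then alternates for exactly one starting
    sign, that of its smaller axis. *)
Lemma alt_edge_sign a b : noncompl a b ->
  alt_edge true a b (+) alt_edge false a b = a.1 (+) b.1.
Proof. by case: a b => [[] []] [[] []]. Qed.

Lemma alt_quad_opp s a b c d :
  alt_quad s (opp_label a) (opp_label b) (opp_label c) (opp_label d) =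
  alt_quad (~~ s) a b c d.
Proof.
rewrite /alt_quad /alt_triangle /=.
have H e : alt_vertex s (opp_label e) = alt_vertex (~~ s) e.
  by case: s e => [] [[] []].
by rewrite !H.
Qed.

Definition noncompl4 a b c d :=
  [&& noncompl a b, noncompl a c, noncompl a d, noncompl b c, noncompl b d
    & noncompl c d].

(* The parity of a labelled square depends neither on the diagonal used to
   triangulate it nor on the order in which its boundary is traversed. *)
Lemma alt_quad_rev s a b c d : noncompl4 a b c d ->
  alt_quad s a b c d = alt_quad s d c b a.
Proof.
by case: s a b c d => [] [[] []] [[] []] [[] []] [[] []].
Qed.

(** A triangle without complementary labels has an odd number of edges alternating from a positive
    sign exactly when it is alternating, with either starting sign. The diagonal lies in both
    triangles and cancels. *)
Lemma alt_quad_boundary a b c d : noncompl4 a b c d ->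
  alt_quad true a b c d (+) alt_quad false a b c d =
  alt_edge true a b (+) alt_edge true d c (+) (alt_edge true a d (+) alt_edge true b c).
Proof.
by case: a b c d => [[] []] [[] []] [[] []] [[] []].
Qed.

(** An alternating face uses all three axes, so the fourth vertex must repeat one of its labels;
    hence either no face or exactly two faces alternate. *)
Lemma alt_tetrahedron a b c d : noncompl4 a b c d ->
  alt_triangle true b c d = alt_triangle true a c d (+) alt_triangle true a b d
     (+) alt_triangle true a b c.
Proof.
by case: a b c d => [[] []] [[] []] [[] []] [[] []].
Qed.

(* Decompose the cube into the six tetrahedra around its diagonal [a c']. *)
Lemma alt_cube a b c d a' b' c' d' :
  noncompl4 a a' b' c' -> noncompl4 a a' d' c' ->
  noncompl4 a b b' c' -> noncompl4 a b c c' ->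
  noncompl4 a d d' c' -> noncompl4 a d c c' ->
  alt_quad true a b c d (+) alt_quad true a' b' c' d'
    (+) (alt_quad true a b b' a' (+) alt_quad true d c c' d')
    (+) (alt_quad true a d d' a' (+) alt_quad true b c c' b') = false.
Proof.
rewrite /alt_quad => /alt_tetrahedron -> /alt_tetrahedron -> /alt_tetrahedron ->.
move=> /alt_tetrahedron -> /alt_tetrahedron -> /alt_tetrahedron ->.
move: (alt_triangle true a b c) (alt_triangle true a d c).
move: (alt_triangle true a b b') (alt_triangle true a d d').
move: (alt_triangle true a a' b') (alt_triangle true a a' d').
move: (alt_triangle true a a' c') (alt_triangle true a b' c').
move: (alt_triangle true a d' c') (alt_triangle true a b c').
move: (alt_triangle true a d c') (alt_triangle true a c c').
by do 12 case.
Qed.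

Lemma addb_telescope (f : nat -> bool) N :
  \big[addb/false]_(i < N) (f i (+) f i.+1) = f 0 (+) f N.
Proof.
elim: N => [|N IH]; first by rewrite big_ord0 addbb.
by rewrite big_ord_recr /= IH addbA addbK.
Qed.

Lemma addb_rev (f : nat -> bool) N :
  \big[addb/false]_(i < N) f (N.-1 - i) = \big[addb/false]_(i < N) f i.
Proof.
rewrite [RHS](reindex_inj rev_ord_inj) /=; apply: eq_bigr => i _.
by congr f; lia.
Qed.

(** The second condition lets coordinates differ by at most one, so that any two corners of a small
    cube are compared, diagonals included. *)
Definition grid_noncompl N (L : nat -> nat -> nat -> label) := forall i j k i' j' k',
  [&& i <= N, j <= N, k <= N, i' <= N, j' <= N & k' <= N] ->
  [&& i <= i'.+1, j <= j'.+1, k <= k'.+1, i' <= i.+1, j' <= j.+1 & k' <= k.+1] ->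
  noncompl (L i j k) (L i' j' k').

Definition plane_noncompl N (L : nat -> nat -> label) := forall i j i' j',
  [&& i <= N, j <= N, i' <= N & j' <= N] ->
  [&& i <= i'.+1, j <= j'.+1, i' <= i.+1 & j' <= j.+1] ->
  noncompl (L i j) (L i' j').

Definition alt_square s (L : nat -> nat -> label) N : bool :=
  \big[addb/false]_(i < N) \big[addb/false]_(j < N)
     alt_quad s (L i j) (L i.+1 j) (L i.+1 j.+1) (L i j.+1).

Definition alt_line s (L : nat -> label) N : bool :=
  \big[addb/false]_(i < N) alt_edge s (L i) (L i.+1).

(** Together the two counts are the number of sign changes along the line, whose parity
    telescopes. *)
Lemma alt_line_sign L N : (forall i, i < N -> noncompl (L i) (L i.+1)) ->
  alt_line true L N (+) alt_line false L N = (L 0).1 (+) (L N).1.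
Proof.
move=> nc; rewrite -big_split /= -(addb_telescope (fun i => (L i).1)).
by apply: eq_bigr => i _; rewrite alt_edge_sign ?nc.
Qed.

Lemma alt_line_opp s L L' N : (forall i, i <= N -> L' i = opp_label (L i)) ->
  alt_line s L' N = alt_line (~~ s) L N.
Proof.
move=> opp; apply: eq_bigr => i _.
by rewrite -alt_edge_opp !opp // ltnW.
Qed.

Lemma alt_line_antipodal s L L' N :
  (forall i, i <= N -> L' i = opp_label (L (N - i))) ->
  alt_line s L' N = alt_line (~~ s) L N.
Proof.
move=> opp; rewrite /alt_line -[RHS](@addb_rev (fun i => alt_edge (~~ s) (L i) (L i.+1))).
apply: eq_bigr => i _.
rewrite -alt_edge_opp alt_edge_sym !opp //; last exact: ltnW.
by congr (alt_edge _ (opp_label (L _)) (opp_label (L _))); have := ltn_ord i; lia.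
Qed.

Lemma alt_square_opp s L L' N :
  (forall i j, i <= N -> j <= N -> L' i j = opp_label (L i j)) ->
  alt_square s L' N = alt_square (~~ s) L N.
Proof.
move=> opp; apply: eq_bigr => i _; apply: eq_bigr => j _.
by rewrite -alt_quad_opp !opp // ltnW.
Qed.

Lemma alt_square_antipodal s L L' N : plane_noncompl N L ->
  (forall i j, i <= N -> j <= N -> L' i j = opp_label (L i (N - j))) ->
  alt_square s L' N = alt_square (~~ s) L N.
Proof.
move=> nc opp; apply: eq_bigr => i _.
rewrite -[RHS](@addb_rev (fun j => alt_quad (~~ s) (L i j) (L i.+1 j) (L i.+1 j.+1) (L i j.+1))).
apply: eq_bigr => j _.
have [iN jN] := (ltn_ord i, ltn_ord j).
rewrite !opp; try lia.
(* Reversing [j] reflects each square and so exchanges its diagonals; [alt_quad_rev] restores the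
   original one. *)
rewrite alt_quad_opp alt_quad_rev; last first.
  by rewrite /noncompl4; do ?[apply/andP; split]; apply: nc; lia.
by congr alt_quad; congr (L _ _); lia.
Qed.

(** Inner edges belong to two small squares and cancel modulo 2; only the four sides remain. *)
Lemma alt_square_boundary L N : plane_noncompl N L ->
  alt_square true L N (+) alt_square false L N =
  alt_line true (L^~ 0) N (+) alt_line true (L^~ N) N
  (+) (alt_line true (L 0) N (+) alt_line true (L N) N).
Proof.
move=> nc; rewrite /alt_square -big_split /=.
under eq_bigr => i _.
  rewrite -big_split /=; under eq_bigr => j _.
    rewrite alt_quad_boundary; last first.
      by have [iN jN] := (ltn_ord i, ltn_ord j); rewrite /noncompl4;
        do ?[apply/andP; split]; apply: nc; lia.
    over.
  rewrite big_split /=; over.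
rewrite big_split /=; congr (_ (+) _).
  rewrite /alt_line -big_split /=; apply: eq_bigr => i _.
  exact: (addb_telescope (fun j => alt_edge true (L i j) (L i.+1 j))).
rewrite exchange_big /alt_line -big_split /=; apply: eq_bigr => j _.
exact: (addb_telescope (fun i => alt_edge true (L i j) (L i j.+1))).
Qed.

(** Summing [alt_cube] over all small cubes, each inner square occurs twice and telescopes away,
    which leaves the six faces. *)
Lemma alt_box_boundary L N : grid_noncompl N L ->
  alt_square true (fun i j => L i j 0) N (+) alt_square true (fun i j => L i j N) N
  (+) (alt_square true (fun i k => L i 0 k) N (+) alt_square true (fun i k => L i N k) N)
  (+) (alt_square true (fun j k => L 0 j k) N (+) alt_square true (fun j k => L N j k) N)
  = false.
Proof.
move=> nc.
pose qz i j k := alt_quad true (L i j k) (L i.+1 j k) (L i.+1 j.+1 k) (L i j.+1 k).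
pose qy i j k := alt_quad true (L i j k) (L i.+1 j k) (L i.+1 j k.+1) (L i j k.+1).
pose qx i j k := alt_quad true (L i j k) (L i j.+1 k) (L i j.+1 k.+1) (L i j k.+1).
have E (i j k : 'I_N) : qz i j k (+) qz i j k.+1 (+) (qy i j k (+) qy i j.+1 k)
     (+) (qx i j k (+) qx i.+1 j k) = false.
  by rewrite /qz /qy /qx alt_cube //;
  have [iN [jN kN]] := (ltn_ord i, (ltn_ord j, ltn_ord k));
  rewrite /noncompl4; do ?[apply/andP; split]; apply: nc; lia.
transitivity (\big[addb/false]_(i < N) \big[addb/false]_(j < N) \big[addb/false]_(k < N)
  (qz i j k (+) qz i j k.+1 (+) (qy i j k (+) qy i j.+1 k)
     (+) (qx i j k (+) qx i.+1 j k))); last first.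
  by apply: big1 => i _; apply: big1 => j _; apply: big1 => k _; exact: E.
under [RHS]eq_bigr => i _.
  under eq_bigr => j _ do rewrite 2!big_split /=.
  rewrite 2!big_split /=; over.
rewrite 2!big_split /=; congr (_ (+) _ (+) _).
- rewrite /alt_square -big_split /=; apply: eq_bigr => i _.
  rewrite -big_split /=; apply: eq_bigr => j _.
  by rewrite (addb_telescope (qz i j)).
- rewrite /alt_square -big_split /=; apply: eq_bigr => i _.
  rewrite exchange_big -big_split /=; apply: eq_bigr => k _.
  by rewrite (addb_telescope (fun j => qy i j k)).
rewrite exchange_big /alt_square -big_split /=; apply: eq_bigr => j _.
rewrite exchange_big -big_split /=; apply: eq_bigr => k _.
by rewrite (addb_telescope (fun i => qx i j k)).
Qed.

(* Antipodality reduces the number of alternating triangles on the boundary of the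
   box, first to boundary edges of three of its faces, then to sign changes along
   lines joining antipodal corners; the result is odd, whereas the cubes make it
   even. *)
Lemma grid_parity_contradiction N L : grid_noncompl N L ->
  (forall j k, j <= N -> k <= N -> L N j k = opp_label (L 0 j k)) ->
  (forall i j k, i <= N -> j <= N -> k <= N ->
     [|| j == 0, j == N, k == 0 | k == N] ->
     L i (N - j) (N - k) = opp_label (L i j k)) ->
  False.
Proof.
move=> nc opp anti.
have signN a : (opp_label a).1 = ~~ a.1 by [].
have ncx : plane_noncompl N (L 0) by move=> *; apply: nc; lia.
have ncy : plane_noncompl N (fun i k => L i 0 k) by move=> *; apply: nc; lia.
have ncz : plane_noncompl N (fun i j => L i j 0) by move=> *; apply: nc; lia.
have := alt_box_boundary nc.
rewrite (@alt_square_opp _ (L 0) (L N)) //.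
rewrite (@alt_square_antipodal _ (fun i k => L i 0 k) (fun i k => L i N k)) //; last first.
  move=> i j iN jN; have := anti i 0 (N - j) iN isT (leq_subr _ _) isT.
  by rewrite subn0 subKn.
rewrite (@alt_square_antipodal _ (fun i k => L i k 0) (fun i k => L i k N)) //; last first.
  move=> i j iN jN; have := anti i (N - j) 0 iN (leq_subr _ _) isT.
  by rewrite subn0 subKn // !orbT; exact.
rewrite /= !alt_square_boundary //.
rewrite (@alt_line_opp _ (L 0 0) (L N 0)); last by move=> i iN; apply: opp.
rewrite (@alt_line_opp _ (fun j => L 0 j 0) (fun j => L N j 0)); last first.
  by move=> i iN; apply: opp.
rewrite (@alt_line_opp _ (fun i => L i 0 N) (fun i => L i N 0)); last first.
  move=> i iN; have := anti i 0 N iN isT (leqnn N) isT.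
  by rewrite subn0 subnn.
rewrite (@alt_line_antipodal _ (L 0 0) (L 0 N)); last first.
  move=> i iN; have := anti 0 0 (N - i) isT isT (leq_subr _ _) isT.
  by rewrite subn0 subKn.
rewrite (@alt_line_antipodal _ (fun j => L 0 j 0) (fun j => L 0 j N)); last first.
  move=> i iN; have := anti 0 (N - i) 0 isT (leq_subr _ _) isT.
  by rewrite subn0 subKn // !orbT; exact.
rewrite /=.
have := @alt_line_sign (L 0 0) N (fun k kN => ltac:(by apply: nc; lia)).
have := @alt_line_sign (fun j => L 0 j 0) N (fun k kN => ltac:(by apply: nc; lia)).
have := @alt_line_sign (fun i => L i 0 N) N (fun k kN => ltac:(by apply: nc; lia)).
rewrite /=.
have -> : L N 0 N = opp_label (L 0 0 N) by apply: opp.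
have -> : L 0 N 0 = opp_label (L 0 0 N).
  by have := anti 0 0 N isT isT (leqnn N) isT; rewrite subn0 subnn.
(* In the total, the line [L i 0 0] and the sign changes along [L 0 0 k] and [L 0 j 0] each occur
   twice. What remains are the sign changes along [L i 0 N], odd in number since its ends carry
   opposite labels. *)
rewrite !signN.
move: (alt_line true (fun i => L i 0 N) N) (alt_line false (fun i => L i 0 N) N).
move: (alt_line true (fun i => L 0 i 0) N) (alt_line false (fun i => L 0 i 0) N).
move: (alt_line true (L 0 0) N) (alt_line false (L 0 0) N).
move: (alt_line true (fun i => L i 0 0) N) (L 0 0 0).1 (L 0 0 N).1.
by do 9 case.
Qed.

Local Open Scope classical_set_scope.
Local Open Scope ring_scope.

(** * Zeros of antipodal maps on the cube *)

(** Ties are broken by the order of the axes and only absolute values enter, so [v] and its negative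
    get the same axis. *)
Definition argmax_norm (R : realType) (v : axis -> R) : axis :=
  if (`|v Ax2| <= `|v Ax1|) && (`|v Ax3| <= `|v Ax1|) then Ax1
  else if `|v Ax3| <= `|v Ax2| then Ax2 else Ax3.

Definition max_label (R : realType) (v : axis -> R) : label :=
  (0 < v (argmax_norm v), argmax_norm v).

Lemma argmax_normP (R : realType) (v : axis -> R) j :
  `|v j| <= `|v (argmax_norm v)|.
Proof.
rewrite /argmax_norm; case: ifPn => [/andP[? ?]|]; first by case: j.
rewrite negb_and -!ltNge => /orP h.
by case: (leP `|v Ax3| `|v Ax2|) => h2; case: j => //; case: h => h; lra.
Qed.

(** A nonzero coordinate makes the largest one nonzero; at the zero vector both signs would be
    [false]. *)
Lemma max_label_opp (R : realType) (v : axis -> R) i : v i != 0 ->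
  max_label (fun j => - v j) = opp_label (max_label v).
Proof.
move=> vi; rewrite /max_label /opp_label.
have -> : argmax_norm (fun j => - v j) = argmax_norm v.
  by rewrite /argmax_norm !normrN.
congr pair; have := argmax_normP v i; set a := v (argmax_norm v) => via.
have a0 : a != 0 by rewrite -normr_gt0 (lt_le_trans _ via) // normr_gt0.
by rewrite oppr_gt0 /= -leNgt le_eqVlt (negbTE a0).
Qed.

(** The largest coordinates of [u] and [v] exceed half of [|v0 i|] in absolute value. Opposite signs
    on a common axis would put them more than [|v0 i|] apart there, although both are within half of
    it from [v0]. *)
Lemma max_label_noncompl (R : realType) (v0 u v : axis -> R) i : v0 i != 0 ->
  (forall j, `|u j - v0 j| < `|v0 i| / 2) -> (forall j, `|v j - v0 j| < `|v0 i| / 2) ->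
  noncompl (max_label u) (max_label v).
Proof.
rewrite -normr_gt0; set M := `|v0 i| => M0.
have large w : (forall j, `|w j - v0 j| < M / 2) -> M / 2 < `|w (argmax_norm w)|.
  move=> wv; apply: lt_le_trans (argmax_normP w i).
  have := lerB_dist (v0 i) (w i); rewrite distrC -/M; have := wv i.
  by lra.
move=> uv vv; have := large _ uv; have := large _ vv.
rewrite /noncompl /max_label /=.
case E : neq_axis => //=.
have <- : argmax_norm u = argmax_norm v.
  by move: E; case: argmax_norm; case: argmax_norm.
have := uv (argmax_norm u); have := vv (argmax_norm u).
move: (argmax_norm u) => j; rewrite !ltr_norml => /andP[? ?] /andP[? ?].
case: (ltP 0 (u j)) => uj; case: (ltP 0 (v j)) => vj //.
  by rewrite (ler0_norm vj) gtr0_norm //; lra.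
by rewrite (ler0_norm uj) gtr0_norm //; lra.
Qed.

Definition cube (R : realType) : set (R * R * R) :=
  (`[-1, 1] `*` `[-1, 1]) `*` `[-1, 1].

Lemma cube_compact (R : realType) : compact (@cube R).
Proof.
apply: compact_setX; last exact: segment_compact.
by apply: compact_setX; exact: segment_compact.
Qed.

(** A Lebesgue number argument: [max_label_noncompl] gives a radius around each point, and
    compactness of the cube a uniform one. *)
Lemma uniform_noncompl (R : realType) (f : axis -> R * R * R -> R) :
  (forall i, continuous (f i)) -> (forall p, cube p -> exists i, f i p != 0) ->
  exists2 d : R, 0 < d & forall p p', cube p -> ball p d p' ->
    noncompl (max_label (f^~ p)) (max_label (f^~ p')).
Proof.
move=> fc fn0.
have /compact_near_coveringP cov := @cube_compact R.
pose P (d : R) p := forall p', ball p d p' ->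
  noncompl (max_label (f^~ p)) (max_label (f^~ p')).
have : \forall d \near 0^'+, @cube R `<=` P d.
  apply: cov => p /fn0 [i fi].
  pose e := `|f i p| / 2.
  have e0 : 0 < e by rewrite divr_gt0 // normr_gt0.
  have near_p j : \forall p' \near p, `|f j p' - f j p| < e.
    have /cvgrPdist_lt/(_ _ e0) := fc j p.
    by apply: filterS => p'; rewrite distrC.
  have : nbhs p [set p' | forall j, `|f j p' - f j p| < e].
    apply: filterS3 (near_p Ax1) (near_p Ax2) (near_p Ax3).
    by move=> p' ? ? ? [].
  rewrite -nbhs_ballE => -[r /= r0 rP].
  have r20 : 0 < r / 2 by rewrite divr_gt0.
  (* Half of [r] is for moving the centre from [p] to [x], the other half for the ball around
     [x]. *)
  exists (ball p (r / 2), [set d | d < r / 2]); first split => /=.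
  - by apply/nbhs_ballP; exists (r / 2).
  - exact: nbhs_right_lt.
  move=> [x d] [/= px dr] p' xp'.
  apply: (max_label_noncompl fi) => j.
    apply: rP; apply: le_ball px; lra.
  apply: rP; rewrite (splitr r); apply: ball_triangle px _.
  by apply: le_ball xp'; exact: ltW.
move=> H.
have [d [dP d0]] : exists d : R, (@cube R `<=` P d) /\ 0 < d.
  apply: (@filter_ex _ (0:R)^'+); apply: filterI => //.
  exact: nbhs_right_gt.
by exists d => // p p' Kp; exact: dP.
Qed.

Definition grid_pt (R : realType) (N i : nat) : R := 2 * i%:R / N%:R - 1.

Lemma grid_pt_itv (R : realType) N i : (i <= N)%N -> grid_pt R N i \in `[-1, 1].
Proof.
(* For [N = 0] the inverse of 0 is 0 by convention, and the point is -1. *)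
case: N => [|N] iN; first by rewrite in_itv /grid_pt /= invr0 mulr0; lra.
have N0 : 0 < N.+1%:R :> R by rewrite ltr0n.
rewrite in_itv /grid_pt /=; apply/andP; split.
  by rewrite lerBrDr addNr divr_ge0 // mulr_ge0.
by rewrite lerBlDr ler_pdivrMr // ler_pM2l // ler_nat.
Qed.

Lemma grid_pt_rev (R : realType) N i : (0 < N)%N -> (i <= N)%N ->
  grid_pt R N (N - i) = - grid_pt R N i.
Proof.
move=> N0 iN; rewrite /grid_pt natrB //.
have N0' : N%:R != 0 :> R by rewrite pnatr_eq0 -lt0n.
by field.
Qed.

Lemma grid_pt0 (R : realType) N : grid_pt R N 0 = -1.
Proof. by rewrite /grid_pt mulr0 mul0r add0r. Qed.

Lemma grid_pt_max (R : realType) N : (0 < N)%N -> grid_pt R N N = 1.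
Proof. by move=> N0; rewrite -[LHS]opprK -grid_pt_rev // subnn grid_pt0 opprK. Qed.

Lemma grid_pt_dist (R : realType) N i j (d : R) : (0 < N)%N -> 2 < d * N%:R ->
  (i <= j.+1)%N -> (j <= i.+1)%N -> ball (grid_pt R N i) d (grid_pt R N j).
Proof.
move=> N0 dN ij ji.
have N0' : 0 < N%:R :> R by rewrite ltr0n.
rewrite /ball /= /grid_pt.
have -> : 2 * i%:R / N%:R - 1 - (2 * j%:R / N%:R - 1) = (2 * (i%:R - j%:R)) / N%:R :> R.
  by rewrite mulrBr mulrBl; ring.
rewrite normrM normfV (gtr0_norm N0') ltr_pdivrMr // (le_lt_trans _ dN) //.
rewrite normrM ger0_norm // -[leRHS]mulr1 ler_pM2l //.
move: ij ji; rewrite -(ler_nat R) -[(j <= _)%N](ler_nat R) -!natr1 => ij ji.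
by rewrite ler_norml; apply/andP; split; lra.
Qed.

Lemma cube_zero (R : realType) (f : axis -> R * R * R -> R) :
  (forall i, continuous (f i)) ->
  (forall i a b, f i (1, a, b) = - f i (-1, a, b)) ->
  (forall i s a b, Num.max `|a| `|b| = 1 -> f i (s, - a, - b) = - f i (s, a, b)) ->
  exists p, forall i, f i p = 0.
Proof.
move=> fc fs fab; apply: contrapT => no0.
have {}no0 p : exists i, f i p != 0.
  apply: contrapT => H; apply: no0; exists p => i.
  by apply/eqP; apply: contrapT => /negP fi; apply: H; exists i.
have [d d0 dP] := @uniform_noncompl _ _ fc (fun p _ => no0 p).
(* This makes the mesh [2 / N] of the grid smaller than [d]. *)
pose N := (Num.trunc (2 / d)).+1.
have N0 : (0 < N)%N by [].
have dN : 2 < d * N%:R.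
  by rewrite mulrC -ltr_pdivrMr //; exact: truncnS_gt.
pose P i j k : R * R * R := (grid_pt R N i, grid_pt R N j, grid_pt R N k).
apply: (@grid_parity_contradiction N (fun i j k => max_label (f^~ (P i j k)))) => //.
- move=> i j k i' j' k' /and5P[iN jN kN _ _] /and5P[ii' jj' kk' i'i /andP[j'j k'k]].
  apply: dP.
    by split; [split|] => /=; exact: grid_pt_itv.
  by split; [split|] => /=; exact: grid_pt_dist.
- move=> j k _ _; rewrite /P grid_pt0 grid_pt_max //.
  have [i fi] := no0 (-1, grid_pt R N j, grid_pt R N k).
  rewrite -(max_label_opp fi); congr max_label.
  by apply/funext => a; exact: fs.
move=> i j k iN jN kN bd; rewrite /P !grid_pt_rev //.
have [a fa] := no0 (grid_pt R N i, grid_pt R N j, grid_pt R N k).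
rewrite -(max_label_opp fa); congr max_label.
apply/funext => c; apply: fab.
have le1 m : (m <= N)%N -> `|grid_pt R N m| <= 1.
  by move=> /(@grid_pt_itv R); rewrite in_itv ler_norml.
have max1 (x y : R) : `|x| <= 1 -> `|y| <= 1 -> `|x| = 1 \/ `|y| = 1 -> Num.max `|x| `|y| = 1.
  by move=> x1 y1 [] ->; [rewrite max_l|rewrite max_r].
apply: max1; [exact: le1|exact: le1|].
case/or4P: bd => /eqP ->; rewrite ?grid_pt0 ?grid_pt_max // ?normrN1 ?normr1;
  by [left|right].
Qed.

(** * Continuity of the imbalance of a mass *)

Lemma aff_opp (R : realType) (l : oline R) x : aff (- l) x = - aff l x.
Proof. by rewrite /aff /= !mulNr -!opprD. Qed.

Lemma measurable_aff (R : realType) (l : oline R) : measurable_fun setT (aff l).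
Proof.
by apply: measurable_funD => //; apply: measurable_funD; apply: measurable_funM.
Qed.

Lemma measurable_bool_set d (T : measurableType d) (b : T -> bool) :
  measurable_fun setT b -> measurable [set x | b x].
Proof.
move=> mb; rewrite -[X in measurable X]setTI.
exact: (mb measurableT [set true]).
Qed.

Lemma aff_dist (R : realType) (l l' : oline R) (d : R) x : ball l d l' ->
  `|aff l x - aff l' x| <= d * (`|x.1| + `|x.2| + 1).
Proof.
case=> -[/= h1 h2] h3; rewrite /ball /= in h1 h2 h3.
have -> : aff l x - aff l' x =
    (l.1.1 - l'.1.1) * x.1 + (l.1.2 - l'.1.2) * x.2 + (l.2 - l'.2).
  by rewrite /aff; ring.
apply: le_trans (ler_normD _ _) _; rewrite mulrDr mulr1 lerD ?(ltW h3) //.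
apply: le_trans (ler_normD _ _) _; rewrite mulrDr !normrM.
by apply: lerD; rewrite ler_wpM2r // ltW.
Qed.

(** The strict inequality makes membership of a point stable under small changes of the lines; for a
    mass distribution and valid lines, the points left out have measure zero. *)
Definition pos_prod (R : realType) (l1 l2 : oline R) : set (R * R) :=
  [set x | 0 < aff l1 x * aff l2 x].

Lemma measurable_pos_prod (R : realType) (l1 l2 : oline R) :
  measurable (pos_prod l1 l2).
Proof.
apply: measurable_bool_set; apply: measurable_fun_ltr => //.
by apply: measurable_funM; exact: measurable_aff.
Qed.

Lemma measurable_line_set (R : realType) (l : oline R) : measurable (line_set l).
Proof.
rewrite (_ : line_set l = [set x | aff l x == 0]); last first.
  by apply/seteqP; split => x /= /eqP.
by apply: measurable_bool_set; apply: measurable_fun_eqr => //; exact: measurable_aff.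
Qed.

(** The set is an increasing union of the sets [E n]. By continuity from below some [E n] has almost
    all of its measure, and that [E n] stays inside [pos_prod] of all sufficiently close pairs of
    lines. *)
Lemma pos_prod_lsc (R : realType) (mu : {measure set (R * R)%type -> \bar R})
    (l1 l2 : oline R) (e : R) : (mu setT < +oo)%E -> 0 < e ->
  exists2 d : R, 0 < d & forall l1' l2', ball l1 d l1' -> ball l2 d l2' ->
    fine (mu (pos_prod l1 l2)) - e < fine (mu (pos_prod l1' l2')).
Proof.
move=> muT e0.
have mufin A : measurable A -> mu A \is a fin_num.
  move=> mA; rewrite ge0_fin_numE //; apply: le_lt_trans muT.
  by apply: le_measure; rewrite ?inE.
pose w (x : R * R) : R := `|x.1| + `|x.2| + 1.
have w0 x : 0 < w x by rewrite ltr_wpDl // addr_ge0.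
(* On [E n] both affine functions are so large that their signs survive a
   perturbation of the coefficients by [1 / (n + 1)]. *)
pose E n := pos_prod l1 l2 `&` [set x | n.+1%:R^-1 * w x < `|aff l1 x|]
  `&` [set x | n.+1%:R^-1 * w x < `|aff l2 x|].
have mw : measurable_fun setT w.
  by apply: measurable_funD => //; apply: measurable_funD; apply: measurableT_comp.
have mE n : measurable (E n).
  have mside l : measurable [set x | n.+1%:R^-1 * w x < `|aff l x|].
    apply: measurable_bool_set; apply: measurable_fun_ltr.
      exact: measurable_funM.
    by apply: measurableT_comp => //; exact: measurable_aff.
  by apply: measurableI => //; apply: measurableI => //; exact: measurable_pos_prod.
have ndE : nondecreasing_seq E.
  move=> m n mn; apply/subsetPset => x [[px x1] x2].
  have le : n.+1%:R^-1 * w x <= m.+1%:R^-1 * w x.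
    by rewrite ler_wpM2r // ?(ltW (w0 x)) // lef_pV2 ?posrE ?ltr0n // ler_nat.
  by split; [split|] => //=; exact: le_lt_trans le _.
have UE : \bigcup_n E n = pos_prod l1 l2.
  apply/seteqP; split => [x [n _ [[]]]//|x px].
  have small l : aff l x != 0 -> \forall n \near \oo, n.+1%:R^-1 * w x < `|aff l x|.
    rewrite -normr_gt0 => lx.
    have : 0 < `|aff l x| / w x by rewrite divr_gt0.
    move=> lw; have := near_infty_natSinv_lt (PosNum lw); apply: filterS => n /=.
    by rewrite ltr_pdivlMr.
  have : aff l1 x * aff l2 x != 0 by rewrite gt_eqF.
  rewrite mulf_eq0 negb_or => /andP[/small s1 /small s2].
  have [n [n1 n2]] := filter_ex (filterI s1 s2).
  by exists n.
have := @nondecreasing_cvg_mu _ _ _ mu E mE.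
rewrite UE => /(_ (measurable_pos_prod _ _) ndE) cvgE.
have [n nE] : exists n, fine (mu (pos_prod l1 l2)) - e < fine (mu (E n)).
  move: cvgE; rewrite -(fineK (mufin _ (measurable_pos_prod l1 l2))).
  move=> /fine_cvgP[_ /cvgrPdist_lt /(_ _ e0)] /filter_ex [n /=].
  by rewrite ltr_norml => /andP[_ h]; exists n; move: h; rewrite /=; lra.
exists n.+1%:R^-1; first by rewrite invr_gt0 ltr0n.
move=> l1' l2' b1 b2; apply: (lt_le_trans nE).
apply: fine_le; rewrite ?mufin //; try exact: measurable_pos_prod.
apply: le_measure; rewrite ?inE //; first exact: measurable_pos_prod.
move=> x [[/= px x1] x2]; have d1 := aff_dist x b1; have d2 := aff_dist x b2.
move: px; rewrite /pos_prod /= => px.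
have same (a a' : R) : `|a - a'| < `|a| -> 0 < a * a'.
  case: (ltgtP a 0) => [a0|a0|->]; last by rewrite normr0 ltNge normr_ge0.
    by rewrite (ltr0_norm a0) ltr_norml => /andP[? ?]; rewrite nmulr_rgt0 //; lra.
  by rewrite (gtr0_norm a0) ltr_norml => /andP[? ?]; rewrite pmulr_rgt0 //; lra.
have h1 := same _ _ (le_lt_trans d1 x1).
have h2 := same _ _ (le_lt_trans d2 x2).
rewrite -(pmulr_rgt0 _ px).
by have := mulr_gt0 h1 h2; congr (0 < _); ring.
Qed.

(** Negating [l1] turns equal strict signs into opposite ones, so the second term measures the other
    class of the two-colouring. *)
Definition imbalance (R : realType) (mu : {measure set (R * R)%type -> \bar R})
    (l1 l2 : oline R) : R :=
  fine (mu (pos_prod l1 l2)) - fine (mu (pos_prod (- l1) l2)).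

Lemma imbalance_oppl (R : realType) (mu : {measure set (R * R)%type -> \bar R}) l1 l2 :
  imbalance mu (- l1) l2 = - imbalance mu l1 l2.
Proof. by rewrite /imbalance opprK opprB. Qed.

Lemma imbalance_oppr (R : realType) (mu : {measure set (R * R)%type -> \bar R}) l1 l2 :
  imbalance mu l1 (- l2) = - imbalance mu l1 l2.
Proof.
rewrite /imbalance opprB.
have E l : pos_prod l (- l2) = pos_prod (- l) l2.
  by apply/seteqP; split => x; rewrite /pos_prod /= !aff_opp mulrN mulNr.
by rewrite !E opprK.
Qed.

Lemma mass_fin_num (R : realType) (mu : {measure set (R * R)%type -> \bar R}) A :
  mass_distribution mu -> measurable A -> mu A \is a fin_num.
Proof.
move=> [_ [muT _]] mA; rewrite ge0_fin_numE //; apply: le_lt_trans muT.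
by apply: le_measure; rewrite ?inE.
Qed.

Lemma mass_line_set (R : realType) (mu : {measure set (R * R)%type -> \bar R}) l :
  mass_distribution mu -> valid_line l -> mu (line_set l) = 0%E.
Proof.
move=> [_ [_ mu0]] vl; have [|/mu0//] := boolP (at_infinity l).
case: l vl => [[a b] c]; rewrite /valid_line /at_infinity /= => vl /andP[/eqP a0 /eqP b0].
rewrite (_ : line_set _ = set0) ?measure0 // -subset0 => x.
rewrite /line_set /aff /= a0 b0 !mul0r !add0r => c0.
by move: vl; rewrite a0 b0 c0 eqxx.
Qed.

Lemma mass_eq_mod_lines (R : realType) (mu : {measure set (R * R)%type -> \bar R})
    l1 l2 (A B : set (R * R)) :
  mass_distribution mu -> valid_line l1 -> valid_line l2 ->
  measurable A -> measurable B -> B `<=` A ->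
  A `<=` B `|` (line_set l1 `|` line_set l2) -> mu A = mu B.
Proof.
move=> mumu v1 v2 mA mB BA AB.
have mlines : measurable (line_set l1 `|` line_set l2).
  by apply: measurableU; exact: measurable_line_set.
apply/eqP; rewrite eq_le; apply/andP; split; last by apply: le_measure; rewrite ?inE.
apply: (@le_trans _ _ (mu (B `|` (line_set l1 `|` line_set l2)))).
  by apply: le_measure; rewrite ?inE //; exact: measurableU.
have lines0 : mu (line_set l1 `|` line_set l2) = 0%E.
  rewrite measureU0; [exact: mass_line_set|exact: measurable_line_set..|exact: mass_line_set].
by rewrite measureU0.
Qed.

Lemma mu_pos_prodD (R : realType) (mu : {measure set (R * R)%type -> \bar R}) l1 l2 :
  mass_distribution mu ->
  fine (mu (pos_prod l1 l2)) + fine (mu (pos_prod (- l1) l2)) =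
  fine (mu (pos_prod l1 l2 `|` pos_prod (- l1) l2)).
Proof.
move=> mumu; have mP l := @measurable_pos_prod R l l2.
rewrite measureU ?fineD ?mass_fin_num //.
rewrite -subset0 => x []; rewrite /pos_prod /= aff_opp mulNr oppr_gt0 => h1 h2.
by have := lt_trans h1 h2; rewrite ltxx.
Qed.

Lemma mu_pos_prodD_le (R : realType) (mu : {measure set (R * R)%type -> \bar R}) l1 l2 :
  mass_distribution mu ->
  fine (mu (pos_prod l1 l2)) + fine (mu (pos_prod (- l1) l2)) <= fine (mu setT).
Proof.
move=> mumu; rewrite mu_pos_prodD //.
have mU : measurable (pos_prod l1 l2 `|` pos_prod (- l1) l2).
  by apply: measurableU; exact: measurable_pos_prod.
by apply: fine_le; rewrite ?mass_fin_num //; apply: le_measure; rewrite ?inE.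
Qed.

Lemma mu_pos_prodD_eq (R : realType) (mu : {measure set (R * R)%type -> \bar R}) l1 l2 :
  mass_distribution mu -> valid_line l1 -> valid_line l2 ->
  fine (mu (pos_prod l1 l2)) + fine (mu (pos_prod (- l1) l2)) = fine (mu setT).
Proof.
move=> mumu v1 v2; rewrite mu_pos_prodD //; congr fine; apply/esym.
apply: (mass_eq_mod_lines mumu v1 v2) => //.
  by apply: measurableU; exact: measurable_pos_prod.
move=> x _; rewrite /pos_prod /line_set /= aff_opp mulNr oppr_gt0.
case: (ltgtP 0 (aff l1 x * aff l2 x)) => [||/esym/eqP]; [by left; left|by left; right|].
by rewrite mulf_eq0 => /orP[/eqP|/eqP]; right; [left|right].
Qed.

(* Lower semicontinuity of both measures suffices, as they add up to at most
   [mu setT], with equality at valid lines. *)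
Lemma imbalance_continuous (R : realType) (mu : {measure set (R * R)%type -> \bar R})
    (l1 l2 : oline R) (e : R) :
  mass_distribution mu -> valid_line l1 -> valid_line l2 -> 0 < e ->
  exists2 d : R, 0 < d & forall l1' l2', ball l1 d l1' -> ball l2 d l2' ->
    `|imbalance mu l1 l2 - imbalance mu l1' l2'| < e.
Proof.
move=> mumu v1 v2 e0; have e20 : 0 < e / 2 by rewrite divr_gt0.
have muT : (mu setT < +oo)%E by case: mumu => _ [].
have [d1 d10 h1] := pos_prod_lsc l1 l2 muT e20.
have [d2 d20 h2] := pos_prod_lsc (- l1) l2 muT e20.
exists (Num.min d1 d2); first by rewrite lt_min d10.
have m1 : Num.min d1 d2 <= d1 by rewrite ge_min lexx.
have m2 : Num.min d1 d2 <= d2 by rewrite ge_min lexx orbT.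
move=> l1' l2' b1 b2.
have := h1 l1' l2' (le_ball m1 b1) (le_ball m1 b2).
have b1' : ball (- l1) d2 (- l1').
  have [[]] := le_ball m2 b1; rewrite /ball /= => h11 h12 h13.
  by split; [split|]; rewrite /ball /= -opprD normrN.
have := h2 (- l1') l2' b1' (le_ball m2 b2).
have := mu_pos_prodD_le l1' l2' mumu; have := mu_pos_prodD_eq mumu v1 v2.
rewrite /imbalance ltr_norml => *; apply/andP; split; lra.
Qed.

(** * Parametrisation of the pairs of lines by the cube *)

(* The direction [(s, 1 - |s|)], for [s] from -1 to 1, makes half a turn, so
   [pencil_line q 1 = - pencil_line q (-1)]. *)
Definition pencil_line (R : realType) (q : R * R) (s : R) : oline R :=
  (s, 1 - `|s|, - (s * q.1 + (1 - `|s|) * q.2)).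

(* The square [[-1, 1]^2] stands for a closed hemisphere of coefficient vectors:
   on its boundary the constant term vanishes, so antipodal points give opposite
   orientations of one line, and its centre gives the line at infinity. *)
Definition disk_line (R : realType) (a b : R) : oline R :=
  (a, b, 1 - Num.max `|a| `|b|).

Lemma pencil_line_finite (R : realType) (q : R * R) s : ~~ at_infinity (pencil_line q s).
Proof.
rewrite /at_infinity /=; case: eqVneq => //= ->.
by rewrite normr0 subr0 oner_neq0.
Qed.

Lemma finite_valid (R : realType) (l : oline R) : ~~ at_infinity l -> valid_line l.
Proof. by apply: contra => /eqP ->; rewrite /at_infinity /= eqxx. Qed.

Lemma disk_line_infinite (R : realType) (a b : R) :
  at_infinity (disk_line a b) -> disk_line a b = (0, 0, 1).
Proof.
move=> /andP[/= /eqP -> /eqP ->]; rewrite /disk_line.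
by rewrite normr0 maxxx subr0.
Qed.

Lemma disk_line_valid (R : realType) (a b : R) : valid_line (disk_line a b).
Proof.
have [/disk_line_infinite ->|/finite_valid//] := boolP (at_infinity (disk_line a b)).
by rewrite /valid_line !xpair_eqE oner_eq0 andbF.
Qed.

Lemma continuous_pair (T U V : topologicalType) (f : T -> U) (g : T -> V) :
  continuous f -> continuous g -> continuous (fun x => (f x, g x)).
Proof. by move=> cf cg x; exact: (cvg_pair (cf x) (cg x)). Qed.

Lemma pencil_line_continuous (R : realType) (q : R * R) : continuous (pencil_line q).
Proof.
have cs : continuous (fun s : R => 1 - `|s|).
  move=> s; apply: (@cvgB _ R^o); first exact: cvg_cst.
  by apply: cvg_norm; exact: cvg_id.
apply: continuous_pair; first by apply: continuous_pair => // s; exact: cvg_id.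
move=> s; apply: (@cvgN _ R^o); apply: (@cvgD _ R^o).
  by apply: cvgM; [exact: cvg_id|exact: cvg_cst].
by apply: cvgM; [exact: cs|exact: cvg_cst].
Qed.

Lemma disk_line_continuous (R : realType) :
  continuous (fun p : R * R => disk_line p.1 p.2).
Proof.
have c1 : continuous (fun p : R * R => p.1) by move=> p; exact: cvg_fst.
have c2 : continuous (fun p : R * R => p.2) by move=> p; exact: cvg_snd.
apply: continuous_pair; first exact: continuous_pair.
move=> p; apply: (@cvgB _ R^o); first exact: cvg_cst.
by apply: (@continuous_max R _ (fun p : R * R => `|p.1|) (fun p => `|p.2|));
  apply: cvg_norm; [exact: c1|exact: c2].
Qed.

(** * From vanishing imbalance to bisection by distinct lines *)

(** Off the two lines, which have no mass, [Rplus] and [Rminus] are the sets of equal and of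
    opposite strict signs. The hypotheses on [pos_side] exclude a line at infinity with negative
    constant, whose positive side is still the whole plane. *)
Lemma bisects_imbalance (R : realType) (mu : {measure set (R * R)%type -> \bar R}) l1 l2 :
  mass_distribution mu -> valid_line l1 -> valid_line l2 ->
  (forall x, pos_side l1 x = (0 <= aff l1 x)) ->
  (forall x, pos_side l2 x = (0 <= aff l2 x)) ->
  imbalance mu l1 l2 = 0 -> bisects [:: l1; l2] mu.
Proof.
move=> mumu v1 v2 p1 p2 /eqP; rewrite subr_eq0 => /eqP im0.
have oddE x : odd (lambda [:: l1; l2] x) = (0 <= aff l1 x) (+) (0 <= aff l2 x).
  by rewrite /lambda /= addn0 oddD !oddb p1 p2.
have mside (l : oline R) : measurable [set x | 0 <= aff l x].
  apply: measurable_bool_set; apply: measurable_fun_ler => //.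
  exact: measurable_aff.
have mplus : measurable (Rplus [:: l1; l2]).
  rewrite (_ : Rplus _ = ([set x | 0 <= aff l1 x] `&` [set x | 0 <= aff l2 x])
     `|` (~` [set x | 0 <= aff l1 x] `&` ~` [set x | 0 <= aff l2 x])); last first.
    apply/seteqP; split => x; rewrite /Rplus /= oddE.
      by case: (0 <= aff l1 x); case: (0 <= aff l2 x) => //; [left|right].
    by case: (0 <= aff l1 x); case: (0 <= aff l2 x) => // -[] [].
  by apply: measurableU; apply: measurableI; (try apply: measurableC); exact: mside.
have RminusE : Rminus [:: l1; l2] = ~` Rplus [:: l1; l2].
  by apply/seteqP; split => x; rewrite /Rminus /Rplus /=; case: odd.
have mminus : measurable (Rminus [:: l1; l2]) by rewrite RminusE; exact: measurableC.
rewrite /bisects.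
rewrite (mass_eq_mod_lines (B := pos_prod l1 l2) mumu v1 v2) //; first last.
- move=> x; rewrite /Rplus /line_set /pos_prod /= oddE.
  case: (ltgtP 0 (aff l1 x)) => h1; case: (ltgtP 0 (aff l2 x)) => h2 //= _.
  + by left; rewrite mulr_gt0.
  + by right; right.
  + by left; rewrite nmulr_rgt0.
  + by right; left.
  + by right; left.
- move=> x; rewrite /Rplus /pos_prod /= oddE.
  case: (ltgtP 0 (aff l1 x)) => h1; case: (ltgtP 0 (aff l2 x)) => h2 //=.
  + by rewrite pmulr_rgt0 // ltNge (ltW h2).
  + by rewrite nmulr_rgt0 // ltNge (ltW h2).
  + by rewrite -h2 mulr0 ltxx.
  + by rewrite -h1 mul0r ltxx.
- exact: measurable_pos_prod.
rewrite [RHS](mass_eq_mod_lines (B := pos_prod (- l1) l2) mumu v1 v2) //; first last.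
- move=> x; rewrite /Rminus /line_set /pos_prod /= oddE aff_opp mulNr oppr_gt0.
  case: (ltgtP 0 (aff l1 x)) => h1; case: (ltgtP 0 (aff l2 x)) => h2 //= _.
  + by left; rewrite pmulr_rlt0.
  + by left; rewrite nmulr_rlt0.
  + by right; right.
  + by right; left.
- move=> x; rewrite /Rminus /pos_prod /= oddE aff_opp mulNr oppr_gt0.
  case: (ltgtP 0 (aff l1 x)) => h1; case: (ltgtP 0 (aff l2 x)) => h2 //=.
  + by rewrite pmulr_rlt0 // ltNge (ltW h2).
  + by rewrite -h2 mulr0 ltxx.
  + by rewrite nmulr_rlt0 // ltNge (ltW h2).
  + by rewrite -h1 mul0r ltxx.
  + by rewrite -h1 mul0r ltxx.
- exact: measurable_pos_prod.
have mP l := @measurable_pos_prod R l l2.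
by rewrite -[LHS]fineK ?mass_fin_num // im0 fineK ?mass_fin_num.
Qed.

(** For proportional lines the product of the affine functions is [c] times a square, so one of the
    two sets is empty and the other carries the whole, positive, mass. *)
Lemma imbalance_same_line (R : realType) (mu : {measure set (R * R)%type -> \bar R}) l1 l2 :
  mass_distribution mu -> valid_line l1 -> valid_line l2 ->
  imbalance mu l1 l2 = 0 -> ~ same_line l1 l2.
Proof.
move=> mumu v1 v2 /eqP; rewrite subr_eq0 => /eqP im0 [c [_ l2E]].
have affE x : aff l2 x = c * aff l1 x by rewrite l2E /aff /=; ring.
have muT0 : 0 < fine (mu setT).
  by apply: fine_gt0; case: mumu => -> [-> _].
have := mu_pos_prodD_eq mumu v1 v2.
have [c0|c0] := leP 0 c.
  rewrite im0 (_ : pos_prod (- l1) l2 = set0) ?measure0 /=; first by lra.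
  rewrite -subset0 => x; rewrite /pos_prod /= aff_opp affE mulNr mulrCA oppr_gt0.
  by rewrite ltNge mulr_ge0 // -expr2 sqr_ge0.
rewrite -im0 (_ : pos_prod l1 l2 = set0) ?measure0 /=; first by lra.
rewrite -subset0 => x; rewrite /pos_prod /= affE mulrCA.
by rewrite ltNge mulr_le0_ge0 ?(ltW c0) // -expr2 sqr_ge0.
Qed.

Theorem theorem4 (R : realType)
  (mu1 mu2 mu3 : {measure set (R * R)%type -> \bar R}) (q : R * R) :
  mass_distribution mu1 -> mass_distribution mu2 -> mass_distribution mu3 ->
  exists l1 l2 : oline R,
    valid_line l1 /\ ~~ at_infinity l1 /\ aff l1 q = 0 /\
    valid_line l2 /\ ~ same_line l1 l2 /\
    bisects [:: l1; l2] mu1 /\ bisects [:: l1; l2] mu2 /\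
    bisects [:: l1; l2] mu3.
Proof.
move=> mass1 mass2 mass3.
pose mu i := match i with Ax1 => mu1 | Ax2 => mu2 | Ax3 => mu3 end.
have mass i : mass_distribution (mu i) by case: i.
pose f i (p : R * R * R) := imbalance (mu i) (pencil_line q p.1.1) (disk_line p.1.2 p.2).
have v1 s : valid_line (pencil_line q s) := finite_valid (pencil_line_finite q s).
have [p p0] : exists p, forall i, f i p = 0.
  apply: cube_zero.
  - move=> i p; apply/cvgrPdist_lt => e e0.
    have [d d0 dP] := imbalance_continuous (mass i) (v1 p.1.1) (disk_line_valid p.1.2 p.2) e0.
    have c1 : continuous (fun p : R * R * R => pencil_line q p.1.1).
      move=> p'; apply: (@continuous_comp _ _ _ (fun p : R * R * R => p.1.1)
        (pencil_line q)); last exact: pencil_line_continuous.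
      apply: (@continuous_comp _ _ _ (fun p : R * R * R => p.1) (fun p : R * R => p.1));
        exact: cvg_fst.
    have c2 : continuous (fun p : R * R * R => disk_line p.1.2 p.2).
      move=> p'; apply: (@continuous_comp _ _ _ (fun p : R * R * R => (p.1.2, p.2))
        (fun p : R * R => disk_line p.1 p.2)); last exact: disk_line_continuous.
      apply: continuous_pair => {}p'; last exact: cvg_snd.
      apply: (@continuous_comp _ _ _ (fun p : R * R * R => p.1) (fun p : R * R => p.2)).
        exact: cvg_fst.
      exact: cvg_snd.
    have n1 : nbhs p [set p' | ball (pencil_line q p.1.1) d (pencil_line q p'.1.1)].
      exact: (c1 p _ (nbhsx_ballx _ _ d0)).
    have n2 : nbhs p [set p' | ball (disk_line p.1.2 p.2) d (disk_line p'.1.2 p'.2)].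
      exact: (c2 p _ (nbhsx_ballx _ _ d0)).
    by apply: (@filterS2 _ (nbhs p) _ _ _ _ _ n1 n2) => p' /= b1 b2; exact: dP.
  (* At both ends of the pencil [1 - |s|] vanishes, so the two lines are opposite orientations of
     the vertical line through [q]. *)
  - move=> i a b; rewrite /f /= -imbalance_oppl; congr imbalance.
    rewrite /pencil_line normrN normr1 subrr !mul0r.
    by congr (_, _, _); rewrite /= ?opprK ?oppr0 ?addr0 ?mulN1r ?mul1r.
  (* On the boundary of the square the constant term is 0, so negating [a] and [b] negates the whole
     line. *)
  move=> i s a b ab; rewrite /f /= -imbalance_oppr; congr imbalance.
  rewrite /disk_line !normrN ab subrr.
  by congr (_, _, _); rewrite /= oppr0.
exists (pencil_line q p.1.1), (disk_line p.1.2 p.2).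
have side1 x : pos_side (pencil_line q p.1.1) x = (0 <= aff (pencil_line q p.1.1) x).
  by rewrite /pos_side (negbTE (pencil_line_finite _ _)).
have side2 x : pos_side (disk_line p.1.2 p.2) x = (0 <= aff (disk_line p.1.2 p.2) x).
  (* The only line at infinity in the family has constant 1, so its affine function is nonnegative
     on the whole plane, as its positive side requires. *)
  rewrite /pos_side; case: ifPn => // /disk_line_infinite ->.
  by rewrite /aff /= !mul0r !add0r ler01.
have bis i := bisects_imbalance (mass i) (v1 _) (disk_line_valid _ _) side1 side2 (p0 i).
split; first exact: v1.
split; first exact: pencil_line_finite.
split; first by rewrite /aff /pencil_line /=; ring.
split; first exact: disk_line_valid.
split; first exact: imbalance_same_line (mass Ax1) (v1 _) (disk_line_valid _ _) (p0 Ax1).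
by split; [exact: (bis Ax1)|split; [exact: (bis Ax2)|exact: (bis Ax3)]].
Qed.
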